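(* Let $\phi:\mathbb{R}^n\to\overline{\mathbb{R}}$ be a reference function of the form $\phi=h\circ\|\cdot\|$ for some $h:\mathbb{R}\to\overline{\mathbb{R}}$. Let $f\in\mathcal{C}^1(\mathbb{R}^n)$ be anisotropically smooth relative to $\phi$ with constant $L>0$, with $f_\star=\inf f>-\infty$, and suppose that, with the same constant $L$, $$\|\nabla\phi^*(\nabla f(x))-\nabla\phi^*(\nabla f(\bar x))\|\le L\|x-\bar x\|\qquad\text{for all }x,\bar x\in\mathbb{R}^n .$$ Let $\beta\in(0,1)$ and $\gamma=\frac{(1-\beta)^2}{L}$, let $x^0\in\mathbb{R}^n$, $m^{-1}=0$, and let $\{x^k\}_{k\in\mathbb{N}_0}$ be generated for $k=0,1,\dots$ by $$m^k=\beta m^{k-1}+(1-\beta)\nabla\phi^*(\nabla f(x^k)),\qquad x^{k+1}=x^k-\gamma m^k .$$ Then, for every integer $K\ge1$, $$\min_{1\le k\le K}\phi(\nabla\phi^*(\nabla f(x^k)))\le\frac1K\left(\frac{f(x^0)-f_\star}{\beta\gamma}+\frac{1}{1-\beta}\,\phi(\nabla\phi^*(\nabla f(x^0)))\right).$$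
   Context: $\overline{\mathbb{R}}=\mathbb{R}\cup\{+\infty\}$; $\|\cdot\|$ is the Euclidean norm on $\mathbb{R}^n$; $\phi^*$ is the convex conjugate of $\phi$. Reference function: $\phi:\mathbb{R}^n\to\overline{\mathbb{R}}$ is strongly convex and even with $\phi(0)=0$; $\operatorname{int}\operatorname{dom}\phi\neq\emptyset$; $\phi\in\mathcal{C}^2(\operatorname{int}\operatorname{dom}\phi)$; and for any sequence $\{x^k\}$ (in $\operatorname{int}\operatorname{dom}\phi$, where $\nabla\phi$ is defined) that converges to some boundary point of $\operatorname{int}\operatorname{dom}\phi$, $\|\nabla\phi(x^k)\|\to+\infty$. (Under these conditions $\phi^*\in\mathcal{C}^2(\mathbb{R}^n)$ and the range of $\nabla\phi$ is all of $\mathbb{R}^n$.) Episcaling: for $\lambda>0$, $(\lambda\star\phi)(x)=\lambda\phi(\lambda^{-1}x)$. Anisotropic smoothness: $f\in\mathcal{C}^1(\mathbb{R}^n)$ is anisotropically smooth relative to $\phi$ with constant $L>0$ if for all $x,\bar x\in\mathbb{R}^n$ $$f(x)\le f(\bar x)+\left(\tfrac1L\star\phi\right)(x-\bar y)-\left(\tfrac1L\star\phi\right)(\bar x-\bar y),\qquad \bar y=\bar x-\tfrac1L\nabla\phi^*(\nabla f(\bar x)).$$ (The right-hand side may be $+\infty$.) *)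

(* Defs.v *)
From HB Require Import structures.
From mathcomp Require Import all_boot all_order all_algebra.
From mathcomp Require Import all_classical all_reals all_analysis.

Set Implicit Arguments.
Unset Strict Implicit.
Unset Printing Implicit Defensive.

Import Order.TTheory GRing.Theory Num.Theory.
Import numFieldNormedType.Exports.

Local Open Scope classical_set_scope.
Local Open Scope ring_scope.

(* The library norm `|x| on 'rV[R]_n is the sup norm: it induces the usual
   topology and notion of differentiability, but the Euclidean norm has to be
   written explicitly. *)
Definition dotp (R : realType) (n : nat) (x y : 'rV[R]_n) : R :=
  \sum_(i < n) x ord0 i * y ord0 i.

Definition enorm (R : realType) (n : nat) (x : 'rV[R]_n) : R :=
  Num.sqrt (dotp x x).

Definition grad (R : realType) (n : nat) (g : 'rV[R]_n -> R) (x : 'rV[R]_n) :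
    'rV[R]_n :=
  \row_(i < n) 'D_(delta_mx ord0 i) g x.

(* C^1 and C^2 are meant for an open set U. *)
Definition C1_on (R : realType) (n : nat) (U : set 'rV[R]_n)
    (g : 'rV[R]_n -> R) : Prop :=
  forall x, U x -> differentiable g x /\ {for x, continuous (grad g)}.

Definition C2_on (R : realType) (n : nat) (U : set 'rV[R]_n)
    (g : 'rV[R]_n -> R) : Prop :=
  C1_on U g /\ forall i : 'I_n, C1_on U (fun x => grad g x ord0 i).

Definition edom (R : realType) (n : nat) (phi : 'rV[R]_n -> \bar R) :
    set 'rV[R]_n :=
  [set x | (phi x < +oo)%E].

(* Restricting to 0 < t < 1 keeps the library convention 0 * +oo = 0 out of
   the inequality. *)
Definition strongly_convex (R : realType) (n : nat)
    (phi : 'rV[R]_n -> \bar R) : Prop :=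
  exists2 mu : R, 0 < mu &
    forall (x y : 'rV[R]_n) (t : R), 0 < t < 1 ->
      (phi (t *: x + (1 - t) *: y)%R <=
       t%:E * phi x + (1 - t)%:E * phi y
       - (mu / 2 * t * (1 - t) * enorm (x - y) ^+ 2)%:E)%E.

Definition conjugate (R : realType) (n : nat) (phi : 'rV[R]_n -> \bar R)
    (y : 'rV[R]_n) : \bar R :=
  ereal_sup [set ((dotp x y)%:E - phi x)%E | x in [set: 'rV[R]_n]].

(* Gradient of an extended-real-valued function, meaningful at points near
   which the function is finite. *)
Definition egrad (R : realType) (n : nat) (phi : 'rV[R]_n -> \bar R) :
    'rV[R]_n -> 'rV[R]_n :=
  grad (fun x => fine (phi x)).

Definition episcale (R : realType) (n : nat) (lambda : R)
    (phi : 'rV[R]_n -> \bar R) (x : 'rV[R]_n) : \bar R :=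
  (lambda%:E * phi (lambda^-1 *: x))%E.

Definition reference_function (R : realType) (n : nat)
    (phi : 'rV[R]_n -> \bar R) : Prop :=
  let U := (edom phi)° in
  [/\ [/\ forall x, phi x != -oo%E,
          strongly_convex phi,
          forall x, phi (- x) = phi x &
          phi 0 = 0%E],
      U !=set0,
      C2_on U (fun x => fine (phi x)) &
      forall (u : nat -> 'rV[R]_n) (p : 'rV[R]_n),
        (forall k, U (u k)) -> (closure U `\` U) p -> u @ \oo --> p ->
        enorm (egrad phi (u k)) @[k --> \oo] --> +oo].

(* The right-hand side may be +oo; for a reference function the subtracted
   term is finite, since
   xb - yb = L^-1 *: egrad (conjugate phi) (grad f xb), so that no +oo - +oo
   arises. *)
Definition anisotropically_smooth (R : realType) (n : nat)
    (phi : 'rV[R]_n -> \bar R) (L : R) (f : 'rV[R]_n -> R) : Prop :=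
  forall x xb : 'rV[R]_n,
    let yb := xb - L^-1 *: egrad (conjugate phi) (grad f xb) in
    ((f x)%:E <= (f xb)%:E + episcale L^-1 phi (x - yb)%R
                 - episcale L^-1 phi (xb - yb)%R)%E.

(* The momentum sequence starts at index -1, so it is shifted by one:
   m k stands for m^{k-1}. *)
Definition momentum_iterates (R : realType) (n : nat)
    (phi : 'rV[R]_n -> \bar R) (f : 'rV[R]_n -> R) (beta gamma : R)
    (x m : nat -> 'rV[R]_n) : Prop :=
  [/\ m 0%N = 0,
      forall k, m k.+1 =
        beta *: m k + (1 - beta) *: egrad (conjugate phi) (grad f (x k)) &
      forall k, x k.+1 = x k - gamma *: m k.+1].

(* Main.v *)
Require Import Defs.
From HB Require Import structures.
From mathcomp Require Import all_boot all_order all_algebra.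
From mathcomp Require Import all_classical all_reals all_analysis.
From mathcomp Require Import ring lra.

Set Implicit Arguments.
Unset Strict Implicit.
Unset Printing Implicit Defensive.

Import Order.TTheory GRing.Theory Num.Theory.
Import numFieldNormedType.Exports.

Local Open Scope classical_set_scope.
Local Open Scope ring_scope.

(* Write g_k for grad phi^* (grad f (x_k)), s = 1 - beta and e_k = g_k - m_k.
   The anisotropic descent inequality at x_k bounds f (x_{k+1}) - f (x_k) by
   L^-1 (phi (g_k - s^2 m_k) - phi (g_k)), and convexity applied to
   g_k - s^2 m_k = (1 - s^2) g_k + s^2 e_k turns this bound into
   gamma (phi (e_k) - phi (g_k)).  Since phi is radial and convex, it is
   monotone in the norm, so the Lipschitz bound |g_{k+1} - g_k| <= s^2 |m_k|
   gives phi (e_{k+1}) <= beta phi (e_k) + beta s^2 phi (m_k), while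
   phi (m_k) <= beta phi (m_{k-1}) + s phi (g_k).  Hence
   f (x_k) + (gamma / s) phi (e_k) + gamma beta^2 phi (m_{k-1})
   decreases by at least gamma beta phi (g_k) at each step.  Only convexity
   with coefficients summing to at most 1 is used, never the triangle
   inequality for the Euclidean norm. *)

(** * Scaling of the Euclidean norm *)

Lemma dotpZZ (R : realType) (n : nat) (a : R) (x : 'rV[R]_n) :
  dotp (a *: x) (a *: x) = a ^+ 2 * dotp x x.
Proof. by rewrite /dotp mulr_sumr; apply: eq_bigr => i _; rewrite !mxE; ring. Qed.

Lemma enormZ (R : realType) (n : nat) (a : R) (x : 'rV[R]_n) :
  enorm (a *: x) = `|a| * enorm x.
Proof. by rewrite /enorm dotpZZ sqrtrM ?sqr_ge0// sqrtr_sqr. Qed.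

Lemma enormN (R : realType) (n : nat) (x : 'rV[R]_n) : enorm (- x) = enorm x.
Proof. by rewrite -scaleN1r enormZ normrN1 mul1r. Qed.

Lemma enorm_ge0 (R : realType) (n : nat) (x : 'rV[R]_n) : 0 <= enorm x.
Proof. exact: sqrtr_ge0. Qed.

(** * Convexity and monotonicity of reference functions *)

Lemma strongly_convex_convex (R : realType) (n : nat)
    (phi : 'rV[R]_n -> \bar R) (x y : 'rV[R]_n) (t : R) :
  strongly_convex phi -> 0 < t < 1 ->
  (phi (t *: x + (1 - t) *: y)%R <= t%:E * phi x + (1 - t)%:E * phi y)%E.
Proof.
case=> mu mu0 sc t01; apply: (le_trans (sc x y t t01)).
case/andP: t01 => t0 t1.
rewrite leeBlDr// leeDl// lee_fin.
apply: mulr_ge0; last exact: sqr_ge0.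
by do 2!(apply: mulr_ge0; last lra); lra.
Qed.

(** The origin is the midpoint of [x] and [- x], where an even [phi] takes equal values. *)
Lemma reference_function_ge0 (R : realType) (n : nat)
    (phi : 'rV[R]_n -> \bar R) (x : 'rV[R]_n) :
  reference_function phi -> (0 <= phi x)%E.
Proof.
case=> -[phiNy sc ev phi0] _ _ _.
have h12 : 0 < (2^-1 : R) < 1 by apply/andP; split; lra.
have := strongly_convex_convex x (- x) sc h12.
have -> : 1 - 2^-1 = 2^-1 :> R by lra.
rewrite scalerN subrr phi0 ev.
case: (phi x) (phiNy x) => [r _| _|//]; last by rewrite leey.
by rewrite -!EFinM -EFinD !lee_fin; lra.
Qed.

Lemma reference_function_scale (R : realType) (n : nat)
    (phi : 'rV[R]_n -> \bar R) (a : R) (x : 'rV[R]_n) :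
  reference_function phi -> 0 <= a <= 1 ->
  (phi (a *: x)%R <= a%:E * phi x)%E.
Proof.
move=> rphi /andP[a0 a1]; case: (rphi) => -[_ sc _ phi0] _ _ _.
have [<-|aN0] := eqVneq 0 a; first by rewrite scale0r phi0 mul0e.
have [->|aN1] := eqVneq a 1; first by rewrite scale1r mul1e.
have a01 : 0 < a < 1 by rewrite !lt_neqAle aN0 a0 aN1 a1.
have := strongly_convex_convex x 0 sc a01.
by rewrite scaler0 addr0 phi0 mule0 adde0.
Qed.

(** The missing weight [1 - (a + b)] is put at the origin, where [phi] vanishes: normalise to a true
    convex combination, then shrink it by [a + b]. *)
Lemma reference_function_subconvex (R : realType) (n : nat)
    (phi : 'rV[R]_n -> \bar R) (a b : R) (x y : 'rV[R]_n) :
  reference_function phi -> 0 <= a -> 0 <= b -> a + b <= 1 ->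
  (phi (a *: x + b *: y)%R <= a%:E * phi x + b%:E * phi y)%E.
Proof.
move=> rphi a0 b0 ab1; case: (rphi) => -[_ sc _ _] _ _ _.
(* Zero weights are split off, since the convexity inequality is available only for [0 < t < 1]. *)
have [->|aN0] := eqVneq a 0.
  rewrite scale0r add0r mul0e add0e.
  by apply: reference_function_scale => //; apply/andP; split; lra.
have [->|bN0] := eqVneq b 0.
  rewrite scale0r addr0 mul0e adde0.
  by apply: reference_function_scale => //; apply/andP; split; lra.
have {aN0}a_gt0 : 0 < a by rewrite lt_neqAle eq_sym aN0.
have {bN0}b_gt0 : 0 < b by rewrite lt_neqAle eq_sym bN0.
have abN0 : a + b != 0 by rewrite gt_eqF// addr_gt0.
pose t := a / (a + b).
have aE : a = (a + b) * t by rewrite /t; field.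
have bE : b = (a + b) * (1 - t) by rewrite /t; field.
have t01 : 0 < t < 1.
  by rewrite /t divr_gt0 ?addr_gt0//= ltr_pdivrMr ?addr_gt0// mul1r ltrDl.
have ab01 : 0 <= a + b <= 1 by rewrite ab1 addr_ge0.
have -> : a *: x + b *: y = (a + b) *: (t *: x + (1 - t) *: y).
  by rewrite scalerDr !scalerA -aE -bE.
have -> : (a%:E * phi x + b%:E * phi y
           = (a + b)%:E * (t%:E * phi x + (1 - t)%:E * phi y))%E.
  have [t0 t1] := andP t01.
  rewrite ge0_muleDr ?mule_ge0 ?reference_function_ge0 ?lee_fin ?subr_ge0 ?ltW//.
  by rewrite !muleA -!EFinM -aE -bE.
apply: (le_trans (reference_function_scale _ rphi ab01)).
by rewrite lee_wpmul2l ?lee_fin ?addr_ge0 ?strongly_convex_convex// ltW.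
Qed.

Lemma reference_function_fine_subconvex (R : realType) (n : nat)
    (phi : 'rV[R]_n -> \bar R) (a b : R) (x y : 'rV[R]_n) :
  reference_function phi -> 0 <= a -> 0 <= b -> a + b <= 1 ->
  phi x \is a fin_num -> phi y \is a fin_num ->
  phi (a *: x + b *: y) \is a fin_num /\
  fine (phi (a *: x + b *: y)) <= a * fine (phi x) + b * fine (phi y).
Proof.
move=> rphi a0 b0 ab1 fx fy.
have := reference_function_subconvex x y rphi a0 b0 ab1.
rewrite -{1}(fineK fx) -{1}(fineK fy) -!EFinM -EFinD => le_comb.
have fc : phi (a *: x + b *: y) \is a fin_num.
  rewrite ge0_fin_numE ?reference_function_ge0//.
  exact: le_lt_trans le_comb (ltry _).
by split=> //; rewrite -lee_fin fineK.
Qed.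

(** By radiality, [x] may be replaced by the multiple of [y] of the same norm, whose factor is at
    most 1. *)
Lemma radial_reference_function_homo (R : realType) (n : nat)
    (phi : 'rV[R]_n -> \bar R) (h : R -> \bar R) (x y : 'rV[R]_n) :
  reference_function phi -> (forall x, phi x = h (enorm x)) ->
  enorm x <= enorm y -> (phi x <= phi y)%E.
Proof.
move=> rphi phih le_xy.
have [y0|yN0] := eqVneq (enorm y) 0.
  by rewrite !phih (_ : enorm x = enorm y)//; have := enorm_ge0 x; lra.
have y_gt0 : 0 < enorm y by rewrite lt_neqAle eq_sym yN0 enorm_ge0.
have t0 : 0 <= enorm x / enorm y by rewrite divr_ge0 ?enorm_ge0.
have t1 : enorm x / enorm y <= 1 by rewrite ler_pdivrMr// mul1r.
have -> : phi x = phi ((enorm x / enorm y) *: y).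
  by rewrite !phih enormZ ger0_norm// divfK.
apply: (@le_trans _ _ ((enorm x / enorm y)%:E * phi y)%E).
  by apply: reference_function_scale => //; rewrite t0.
by rewrite -[leRHS]mul1e lee_wpmul2r ?reference_function_ge0// lee_fin.
Qed.

(** * Anisotropic descent in real terms *)

(* In \bar R, y - +oo = -oo for every y, so that an infinite
   [phi (grad phi^* (grad f xb))] would contradict anisotropic smoothness. *)
Lemma anisotropically_smooth_fin_num (R : realType) (n : nat)
    (phi : 'rV[R]_n -> \bar R) (L : R) (f : 'rV[R]_n -> R) (xb : 'rV[R]_n) :
  reference_function phi -> 0 < L -> anisotropically_smooth phi L f ->
  phi (egrad (conjugate phi) (grad f xb)) \is a fin_num.
Proof.
move=> rphi L0 /(_ xb xb) /=; set g := egrad _ _.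
rewrite opprB addrCA subrr addr0 /episcale scalerA mulVf ?invr_neq0 ?gt_eqF//.
rewrite scale1r => ineq.
rewrite ge0_fin_numE ?reference_function_ge0// ltey.
apply/eqP => gy; move: ineq.
by rewrite gy gt0_muley ?lte_fin ?invr_gt0//= addeNy leeNy_eq.
Qed.

(** With [yb = xb - L^-1 *: g], the point [xb - d - yb] is [L^-1 *: (g - L *: d)], so the episcaling
    cancels the inner factor and leaves [L^-1] outside. *)
Lemma anisotropically_smooth_step (R : realType) (n : nat)
    (phi : 'rV[R]_n -> \bar R) (L : R) (f : 'rV[R]_n -> R)
    (xb d : 'rV[R]_n) :
  let g := egrad (conjugate phi) (grad f xb) in
  0 < L -> anisotropically_smooth phi L f ->
  phi g \is a fin_num -> phi (g - L *: d) \is a fin_num ->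
  f (xb - d) <= f xb + L^-1 * (fine (phi (g - L *: d)) - fine (phi g)).
Proof.
move=> g L0 /(_ (xb - d) xb) /=; rewrite -/g => + fg fd.
rewrite (_ : xb - d - _ = L^-1 *: (g - L *: d)); last first.
  by rewrite scalerBr scalerA mulVf ?gt_eqF// scale1r opprB addrCA addrAC subrr add0r.
rewrite opprB addrCA subrr addr0 /episcale !scalerA mulVf ?invr_neq0 ?gt_eqF//.
rewrite !scale1r -(fineK fg) -(fineK fd) -!EFinM -!EFinD lee_fin /=.
by rewrite mulrBr addrA.
Qed.

(** * Telescoping, and minimum against mean *)

Lemma telescope_le (R : realType) (V g : nat -> R) (c : R) (K : nat) :
  (forall k, V k.+1 + c * g k <= V k) ->
  V K + c * \sum_(0 <= k < K) g k <= V 0%N.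
Proof.
move=> dec; elim: K => [|K IH]; first by rewrite big_nil mulr0 addr0.
by rewrite big_nat_recr//= mulrDr; have := dec K; lra.
Qed.

Lemma bigmin_le_mean (R : realType) (u : nat -> \bar R) (B : R) (K : nat) :
  (0 < K)%N -> (forall k, u k \is a fin_num) ->
  \sum_(1 <= k < K.+1) fine (u k) <= B ->
  (\big[Order.min/+oo]_(1 <= k < K.+1) u k <= (K%:R^-1 * B)%:E)%E.
Proof.
move=> K0 fu sumB.
have K0' : 0 < K%:R :> R by rewrite ltr0n.
rewrite leNgt; apply/negP => lt_min.
suff : B < \sum_(1 <= k < K.+1) fine (u k) by rewrite ltNge sumB.
have -> : B = \sum_(1 <= k < K.+1) K%:R^-1 * B.
  by rewrite sumr_const_nat subn1/= -[RHS]mulr_natl mulrA mulfV ?mul1r// gt_eqF//.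
apply: ltr_sum_nat => // k /andP[k1 kK].
rewrite -lte_fin fineK//; apply: (lt_le_trans lt_min).
by apply: ge_bigmin_seq => //; rewrite mem_index_iota k1.
Qed.

(** * Recursions for the momentum and its error *)

(** Finiteness must be carried along the induction, starting from [phi 0 = 0], before the convexity
    bound makes sense in [R]. *)
Lemma momentum_fine_bound (R : realType) (n : nat)
    (phi : 'rV[R]_n -> \bar R) (b : R) (g m : nat -> 'rV[R]_n) :
  reference_function phi -> 0 < b < 1 ->
  (forall k, phi (g k) \is a fin_num) ->
  m 0%N = 0 -> (forall k, m k.+1 = b *: m k + (1 - b) *: g k) ->
  (forall k, phi (m k) \is a fin_num) /\
  (forall k, fine (phi (m k.+1)) <=
             b * fine (phi (m k)) + (1 - b) * fine (phi (g k))).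
Proof.
move=> rphi /andP[b0 b1] fg m0 mS.
have comb k : phi (m k) \is a fin_num -> phi (m k.+1) \is a fin_num /\
    fine (phi (m k.+1)) <= b * fine (phi (m k)) + (1 - b) * fine (phi (g k)).
  by move=> fm; rewrite mS; apply: reference_function_fine_subconvex => //; lra.
have fm k : phi (m k) \is a fin_num.
  elim: k => [|k IH]; last by case: (comb k IH).
  by case: rphi => -[_ _ _ phi0] _ _ _; rewrite m0 phi0.
by split=> // k; case: (comb k (fm k)).
Qed.

(* e_{k+1} = b e_k + b (1 - b)^2 d_k, where d_k, the increment of g divided by
   (1 - b)^2, is no longer than m_k, and the coefficients sum to less than 1. *)
Lemma momentum_error_fine_bound (R : realType) (n : nat)
    (phi : 'rV[R]_n -> \bar R) (h : R -> \bar R) (b : R)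
    (g m : nat -> 'rV[R]_n) :
  reference_function phi -> (forall x, phi x = h (enorm x)) -> 0 < b < 1 ->
  (forall k, phi (g k) \is a fin_num) -> (forall k, phi (m k) \is a fin_num) ->
  m 0%N = 0 -> (forall k, m k.+1 = b *: m k + (1 - b) *: g k) ->
  (forall k, enorm (g k.+1 - g k) <= (1 - b) ^+ 2 * enorm (m k.+1)) ->
  let e k := g k - m k.+1 in
  [/\ forall k, phi (e k) \is a fin_num,
      fine (phi (e 0%N)) <= b * fine (phi (g 0%N)) &
      forall k, fine (phi (e k.+1)) <=
        b * fine (phi (e k)) + b * (1 - b) ^+ 2 * fine (phi (m k.+1))].
Proof.
move=> rphi phih /andP[b0 b1] fg fm m0 mS dg e.
have s0 : 0 < (1 - b) ^+ 2 by rewrite exprn_gt0//; lra.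
have bs : b + b * (1 - b) ^+ 2 <= 1.
  (* This product is exactly the slack [1 - b - b * (1 - b) ^+ 2]. *)
  have : 0 <= (1 - b) * (1 - b * (1 - b)) by rewrite mulr_ge0//; nra.
  by nra.
pose d k := ((1 - b) ^+ 2)^-1 *: (g k.+1 - g k).
have le_d k : (phi (d k) <= phi (m k.+1))%E.
  apply: (radial_reference_function_homo rphi phih).
  by rewrite enormZ gtr0_norm ?invr_gt0// ler_pdivrMl.
have fd k : phi (d k) \is a fin_num.
  rewrite ge0_fin_numE ?reference_function_ge0//.
  by apply: (le_lt_trans (le_d k)); rewrite -ge0_fin_numE ?reference_function_ge0.
(* The zero term only gives the two-term shape of the subconvexity bound. *)
have eE0 : e 0%N = b *: g 0%N + 0 *: g 0%N.
  by rewrite /e mS m0; apply/rowP => i; rewrite !mxE; ring.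
have eES k : e k.+1 = b *: e k + (b * (1 - b) ^+ 2) *: d k.
  rewrite /d scalerA mulfK ?gt_eqF// /e (mS k.+1).
  by apply/rowP => i; rewrite !mxE; ring.
have e0P : phi (e 0%N) \is a fin_num /\
    fine (phi (e 0%N)) <= b * fine (phi (g 0%N)) + 0 * fine (phi (g 0%N)).
  by rewrite eE0; apply: reference_function_fine_subconvex => //; lra.
have eSP k : phi (e k) \is a fin_num -> phi (e k.+1) \is a fin_num /\
    fine (phi (e k.+1)) <=
      b * fine (phi (e k)) + b * (1 - b) ^+ 2 * fine (phi (d k)).
  move=> fe; rewrite eES; apply: reference_function_fine_subconvex => //.
    exact: ltW.
  by rewrite mulr_ge0// ltW.
have fe k : phi (e k) \is a fin_num.
  by elim: k => [|k IH]; [case: e0P | case: (eSP k IH)].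
split=> //; first by case: e0P => _; lra.
move=> k; case: (eSP k (fe k)) => _ /le_trans; apply.
rewrite lerD2l ler_wpM2l ?fine_le//.
by rewrite mulr_ge0// ltW.
Qed.

(** * The potential and its decrease *)

(* The weights of [a] and [M] in the potential come from summing the two
   recursions as geometric series. *)
Lemma lyapunov_step (R : realFieldType) (b t F F' a a' M M' G : R) :
  0 < t -> 0 < b < 1 -> 0 <= G ->
  F' <= F - t * (1 - b) * G + t * (1 - b) * a ->
  a' <= b * a + b * (1 - b) ^+ 2 * M' ->
  M' <= b * M + (1 - b) * G ->
  F' + t * a' + t * (1 - b) * b ^+ 2 * M' + t * (1 - b) * b * G
  <= F + t * a + t * (1 - b) * b ^+ 2 * M.
Proof.
move=> t0 /andP[b0 b1] G0 le_F le_a le_M.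
have s0 : 0 < 1 - b by lra.
have {}le_a : t * a' <= t * (b * a + b * (1 - b) ^+ 2 * M') by rewrite ler_pM2l.
(* The coefficient [t * b * (1 - b)] is the total weight of [M']: its weight in the potential plus
   the one coming from the bound on [a']. *)
have {}le_M : t * b * (1 - b) * M' <= t * b * (1 - b) * (b * M + (1 - b) * G).
  by rewrite ler_pM2l// !mulr_gt0.
(* This is the surplus in [G] left once the terms in [a], [M] and [M'] cancel. *)
have {}G0 : 0 <= t * (1 - b) * (1 - b) * (1 - b) * G by rewrite !mulr_ge0// ltW.
by lra.
Qed.

Theorem theorem2p7 (R : realType) (n : nat)
    (phi : 'rV[R]_n -> \bar R) (hphi : reference_function phi)
    (h : R -> \bar R) (hh : forall t, h t != -oo%E)
    (hphih : forall x, phi x = h (enorm x))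
    (f : 'rV[R]_n -> R) (hf : C1_on [set: 'rV[R]_n] f)
    (L : R) (hL : 0 < L) (hsmooth : anisotropically_smooth phi L f)
    (hinf : has_lbound (range f))
    (hlip : forall x xb : 'rV[R]_n,
       enorm (egrad (conjugate phi) (grad f x)
              - egrad (conjugate phi) (grad f xb)) <= L * enorm (x - xb))
    (beta gamma : R) (hbeta : 0 < beta < 1)
    (hgamma : gamma = (1 - beta) ^+ 2 / L)
    (x m : nat -> 'rV[R]_n)
    (hxm : momentum_iterates phi f beta gamma x m)
    (K : nat) (hK : (1 <= K)%N) :
  (\big[Order.min/+oo]_(1 <= k < K.+1)
      phi (egrad (conjugate phi) (grad f (x k)))
   <= (K%:R^-1)%:E *
      (((f (x 0%N) - inf (range f)) / (beta * gamma))%:E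
       + ((1 - beta)^-1)%:E
         * phi (egrad (conjugate phi) (grad f (x 0%N)))))%E.
Proof.
have [b0 b1] := andP hbeta; have [m0 mS xS] := hxm.
pose g k := egrad (conjugate phi) (grad f (x k)).
have s0 : 0 < 1 - beta by lra.
have gamma0 : 0 < gamma by rewrite hgamma divr_gt0// exprn_gt0.
(* This identity fixes the step size: it yields the factor [(1 - beta) ^+ 2] both in the Lipschitz
   bound and in the descent inequality. *)
have Lgamma : L * gamma = (1 - beta) ^+ 2 by rewrite hgamma; field; rewrite gt_eqF.
have fg k : phi (g k) \is a fin_num by apply: anisotropically_smooth_fin_num hsmooth.
have [fm le_m] := momentum_fine_bound hphi hbeta fg m0 mS.
have dg k : enorm (g k.+1 - g k) <= (1 - beta) ^+ 2 * enorm (m k.+1).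
  apply: (le_trans (hlip _ _)).
  by rewrite xS addrAC subrr add0r enormN enormZ gtr0_norm// mulrA Lgamma.
have [fe le_e0 le_e] := momentum_error_fine_bound hphi hphih hbeta fg fm m0 mS dg.
have step k : f (x k.+1) <= f (x k) - gamma * fine (phi (g k))
                            + gamma * fine (phi (g k - m k.+1)).
  have c0 : 0 <= (1 - beta) ^+ 2 by rewrite sqr_ge0.
  have c1 : 0 <= 1 - (1 - beta) ^+ 2 by nra.
  have c01 : 1 - (1 - beta) ^+ 2 + (1 - beta) ^+ 2 <= 1 by rewrite subrK.
  have := reference_function_fine_subconvex hphi c1 c0 c01 (fg k) (fe k).
  rewrite (_ : _ *: g k + _ = g k - L *: (gamma *: m k.+1)); last first.
    by rewrite scalerA Lgamma; apply/rowP => i; rewrite !mxE; ring.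
  case=> fd le_d.
  rewrite xS; apply: (le_trans (anisotropically_smooth_step hL hsmooth (fg k) fd)).
  rewrite -/(g k) -addrA lerD2l -mulrN -mulrDr.
  rewrite [gamma in leRHS]hgamma [_ / L]mulrC -mulrA ler_pM2l ?invr_gt0//.
  rewrite lerBlDr; apply: (le_trans le_d).
  by rewrite le_eqVlt; apply/orP; left; apply/eqP; ring.
(* By the index shift, the error uses the current momentum [m k.+1], while the last term uses the
   previous one, [m k]. *)
pose V k := f (x k) + gamma / (1 - beta) * fine (phi (g k - m k.+1))
            + gamma * beta ^+ 2 * fine (phi (m k)).
have decV k : V k.+1 + gamma * beta * fine (phi (g k)) <= V k.
  have t0 : 0 < gamma / (1 - beta) by rewrite divr_gt0.
  have tE : gamma / (1 - beta) * (1 - beta) = gamma by rewrite divfK ?gt_eqF.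
  have G0 : 0 <= fine (phi (g k)) by rewrite fine_ge0// reference_function_ge0.
  have := lyapunov_step t0 hbeta G0 _ (le_e k) (le_m k).
  by rewrite tE; apply; apply: step.
(* The sum runs over the indices 0 to [K]; its nonnegative term at 0 is dropped later, leaving the
   [K] terms of the minimum. *)
have := @telescope_le _ V (fun k => fine (phi (g k))) _ K.+1 decV.
have inf_le : inf (range f) <= f (x K.+1) by apply: ge_inf => //; exists (x K.+1).
have V_ge : inf (range f) <= V K.+1.
  rewrite /V -addrA ler_wpDr// addr_ge0// mulr_ge0 ?fine_ge0 ?reference_function_ge0//.
    by rewrite divr_ge0// ltW.
  by rewrite mulr_ge0 ?sqr_ge0// ltW.
(* The factor [beta] in the bound on the initial error cancels on division by [beta * gamma], which
   leaves the coefficient [(1 - beta)^-1]. *)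
have V0_le : V 0%N <= f (x 0%N) + gamma * beta * ((1 - beta)^-1 * fine (phi (g 0%N))).
  case: (hphi) => -[_ _ _ phi0] _ _ _.
  rewrite /V m0 phi0 /= mulr0 addr0 lerD2l -!mulrA ler_pM2l//.
  by rewrite mulrCA ler_pM2l ?invr_gt0.
rewrite big_nat_recl//= mulrDr => tele.
have g00 : 0 <= gamma * beta * fine (phi (g 0%N)).
  by rewrite !mulr_ge0 ?fine_ge0 ?reference_function_ge0// ltW.
have sum_le : \sum_(1 <= k < K.+1) fine (phi (g k)) <=
    (f (x 0%N) - inf (range f)) / (beta * gamma)
    + (1 - beta)^-1 * fine (phi (g 0%N)).
  have bg0 : 0 < beta * gamma by rewrite mulr_gt0.
  rewrite -lerBlDr ler_pdivlMr// big_add1/=; lra.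
have rhsE (a b c : R) (z : \bar R) : z \is a fin_num ->
    (a%:E * (b%:E + c%:E * z))%E = (a * (b + c * fine z))%:E.
  by case: z.
rewrite rhsE; last exact: fg.
exact: bigmin_le_mean hK fg sum_le.
Qed.
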